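(* If $\gamma$ is a unit speed magnetic geodesic on $(\mathbb S^3,g,s\,\mathrm d\alpha)$, $s\ge0$, with contact angle $\psi\in[0,\pi]$, then $\pi(\gamma)$ is a constant speed magnetic geodesic on $\mathbb S^2(\tfrac12)$. More precisely, after an orientation-preserving reparametrization $\pi(\gamma)$ is a unit speed magnetic geodesic of $\big(\mathbb S^2(\tfrac12),g,a_s(\psi)\sigma\big)$ with \[ a_s:(0,\pi)\to\mathbb R,\qquad a_s(\psi)=\frac{2}{\tan(\mathrm{Arg}(C_s(\psi)))}=\frac{2\cos\psi-s}{\sin\psi}. \] In particular, the projected curve $\pi(\gamma)$ is a geodesic circle of radius \[ r_s(\psi):=\tfrac12\mathrm{Arg}(C_s(\psi))\in\big[0,\tfrac\pi2\big]. \]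
   Context: $\mathbb S^3$ is the unit sphere in $\mathbb C^2$ with standard Hermitian product $\langle\cdot,\cdot\rangle$; on it $g=\mathrm{Re}\langle\cdot,\cdot\rangle$ and $\alpha_z=\tfrac12\mathrm{Re}\langle\mathrm iz,\cdot\rangle$. $\mathbb S^2(\tfrac12)\subset\mathbb R^3\equiv\mathbb C\times\mathbb R$ is the Euclidean sphere of radius $\tfrac12$ with its round metric, also denoted $g$, and $\pi:\mathbb S^3\to\mathbb S^2(\tfrac12)$, $\pi(z_1,z_2)=\tfrac12(2\bar z_1z_2,|z_1|^2-|z_2|^2)$ is the Hopf map, which is a Riemannian submersion. $\sigma$ is the area form of $\mathbb S^2(\tfrac12)$, with $\pi^*\sigma=\mathrm d\alpha$. For a Riemannian manifold $(M,g)$ and a closed two-form $\sigma$, the Lorentz force $Y$ is given by $g(Yu,v)=\sigma(u,v)$, and magnetic geodesics of $(M,g,\sigma)$ are curves with $\nabla_{\dot\gamma}\dot\gamma=Y_\gamma\dot\gamma$ ($\nabla$ the Levi-Civita connection). The contact angle of a unit speed magnetic geodesic $\gamma$ of $(\mathbb S^3,g,s\,\mathrm d\alpha)$ is the (constant) $\psi\in[0,\pi]$ with $\cos\psi=g_\gamma(\mathrm i\gamma,\dot\gamma)$. For $s\ge0$ and $\psi\in[0,\pi]$, $C_s(\psi):=(-\tfrac s2+\cos\psi,\sin\psi)\in\mathbb R^2$; $\mathrm{Arg}(C_s(\psi))\in[0,\pi]$ is the angle it makes with the positive $x$-axis as seen from the origin, with the convention $\mathrm{Arg}(C_2(0))=\tfrac\pi2$;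 $2/\tan(\tfrac\pi2)$ is understood as $0$. A geodesic circle of radius $r\in[0,\tfrac\pi2]$ is the set of points at distance $r$ from some point of $\mathbb S^2(\tfrac12)$ (a single point if $r\in\{0,\tfrac\pi2\}$).
   Formalization: With the stated conventions the projected curve is a magnetic geodesic of strength −a_s(ψ)σ, not a_s(ψ)σ, so the sign is corrected; the circle claim excludes (s,ψ)=(2,0), where π(γ) is a point although the convention gives r_2(0)=π/4. *)

(* Defs.v *)
From Stdlib Require Import Reals.
From Coquelicot Require Import Coquelicot.
Open Scope R_scope.

(** * Round spheres in a Euclidean space

    [V] is the ambient real vector space and [ip] its Euclidean inner product;
    the sphere of radius [rho] about the origin carries the induced metric. *)

Definition on_sphere {V : NormedModule R_AbsRing} (ip : V -> V -> R) (rho : R)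
    (p : V) : Prop :=
  ip p p = rho ^ 2.

Definition tangent {V : NormedModule R_AbsRing} (ip : V -> V -> R) (p v : V) : Prop :=
  ip p v = 0.

(** Differential forms are represented by ambient ones; only their values on
    tangent vectors at points of the sphere are ever used. *)
Definition form1 (V : NormedModule R_AbsRing) : Type := V -> V -> R.
Definition form2 (V : NormedModule R_AbsRing) : Type := V -> V -> V -> R.

Definition scale_form {V : NormedModule R_AbsRing} (c : R) (sg : form2 V) : form2 V :=
  fun p u v => c * sg p u v.

(** [d al (u, v) = D_u (al v) - D_v (al u)] for constant vector fields [u], [v]
    of the ambient space; [d] commutes with restriction to the sphere. *)
Definition ext_deriv {V : NormedModule R_AbsRing} (al : form1 V) : form2 V :=
  fun p u v =>
    Derive (fun t : R => al (plus p (scal t u)) v) 0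
    - Derive (fun t : R => al (plus p (scal t v)) u) 0.

(** [w = Y_p u], where [Y] is the Lorentz force of [sg]. *)
Definition is_lorentz_force {V : NormedModule R_AbsRing} (ip : V -> V -> R)
    (sg : form2 V) (p u w : V) : Prop :=
  tangent ip p w /\ forall v : V, tangent ip p v -> ip w v = sg p u v.

(** Covariant derivative of the velocity of a curve on the sphere that passes
    through [p] with ambient acceleration [acc]: for the Levi-Civita connection
    of a submanifold of a Euclidean space it is the tangential part of [acc]. *)
Definition cov_accel {V : NormedModule R_AbsRing} (ip : V -> V -> R) (p acc : V) : V :=
  minus acc (scal (ip p acc / ip p p) p).

Definition is_magnetic_geodesic {V : NormedModule R_AbsRing} (ip : V -> V -> R)
    (rho : R) (sg : form2 V) (gam : R -> V) : Prop :=
  (forall t : R, on_sphere ip rho (gam t)) /\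
  exists gam' gam'' : R -> V,
    (forall t : R, is_derive gam t (gam' t)) /\
    (forall t : R, is_derive gam' t (gam'' t)) /\
    forall t : R,
      is_lorentz_force ip sg (gam t) (gam' t) (cov_accel ip (gam t) (gam'' t)).

Definition has_speed {V : NormedModule R_AbsRing} (ip : V -> V -> R)
    (gam : R -> V) (c : R) : Prop :=
  forall t : R, exists v : V, is_derive gam t v /\ sqrt (ip v v) = c.

Definition is_curve_length {V : NormedModule R_AbsRing} (ip : V -> V -> R)
    (rho : R) (p q : V) (L : R) : Prop :=
  exists c c' : R -> V,
    c 0 = p /\ c 1 = q /\
    (forall t : R, 0 <= t <= 1 ->
       on_sphere ip rho (c t) /\ is_derive c t (c' t) /\ continuous c' t) /\
    L = RInt (fun t : R => sqrt (ip (c' t) (c' t))) 0 1.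

(** Riemannian distance: infimum of the lengths of the [C^1] curves on the
    sphere joining the two points. *)
Definition sphere_dist {V : NormedModule R_AbsRing} (ip : V -> V -> R)
    (rho : R) (p q : V) : Rbar :=
  Glb_Rbar (is_curve_length ip rho p q).

Definition geodesic_circle {V : NormedModule R_AbsRing} (ip : V -> V -> R)
    (rho : R) (p : V) (r : R) (q : V) : Prop :=
  on_sphere ip rho q /\ sphere_dist ip rho p q = Finite r.

(** Orientation-preserving diffeomorphisms of the real line. *)
Definition is_reparam (phi : R -> R) : Prop :=
  (forall (n : nat) (t : R), ex_derive_n phi n t) /\
  (forall t : R, 0 < Derive phi t) /\
  (forall y : R, exists t : R, phi t = y).

(** * The three-sphere in [C^2] *)

Definition C2 : NormedModule R_AbsRing :=
  prod_NormedModule R_AbsRing C_R_NormedModule C_R_NormedModule.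

Definition herm (z w : C2) : C :=
  (fst z * Cconj (fst w) + snd z * Cconj (snd w))%C.

Definition gC2 (z w : C2) : R := Re (herm z w).

Definition mul_i (z : C2) : C2 := ((Ci * fst z)%C, (Ci * snd z)%C).

Definition alpha : form1 C2 := fun z v => / 2 * gC2 (mul_i z) v.

Definition contact_angle (gam : R -> C2) (psi : R) : Prop :=
  0 <= psi <= PI /\
  forall t : R, exists v : C2,
    is_derive gam t v /\ cos psi = gC2 (mul_i (gam t)) v.

(** * The sphere of radius 1/2 in [C x R] and the Hopf map *)

Definition CR : NormedModule R_AbsRing :=
  prod_NormedModule R_AbsRing C_R_NormedModule R_NormedModule.

Definition gCR (p q : CR) : R := Re (fst p * Cconj (fst q))%C + snd p * snd q.

Definition hopf (z : C2) : CR :=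
  ((Cconj (fst z) * snd z)%C, / 2 * (Cmod (fst z) ^ 2 - Cmod (snd z) ^ 2)).

Definition det3 (a b c : CR) : R :=
  Re (fst a) * (Im (fst b) * snd c - snd b * Im (fst c))
  - Im (fst a) * (Re (fst b) * snd c - snd b * Re (fst c))
  + snd a * (Re (fst b) * Im (fst c) - Im (fst b) * Re (fst c)).

(** Area form of the sphere of radius 1/2 with respect to the outward unit
    normal [2 p]. With this orientation [hopf^* area_form = d alpha]. *)
Definition area_form : form2 CR := fun p u v => det3 (scal 2 p) u v.

(** * The angle [Arg (C_s psi)] and the functions [a_s] and [r_s] *)

(** Angle in [[0, PI]] between [c] and the positive first axis; the zero vector
    gets [PI / 2]. *)
Definition Arg (c : R * R) : R :=
  let n := sqrt (fst c ^ 2 + snd c ^ 2) in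
  if Req_EM_T n 0 then PI / 2 else acos (fst c / n).

Definition C_vec (s psi : R) : R * R := (- (s / 2) + cos psi, sin psi).

Definition two_over_tan (theta : R) : R :=
  if Req_EM_T theta (PI / 2) then 0 else 2 / tan theta.

(** Sign: with [hopf^* area_form = d alpha] and [g (Y u) v = area_form u v], the
    projection of a magnetic geodesic of [s d alpha] is, up to orientation-preserving
    reparametrization, a magnetic geodesic of [- a_s * area_form], not of
    [a_s * area_form].  For [s = 0] and the great circle
    [gam t = (cos t + i cos psi sin t, sin psi sin t)] one finds
    [fst (hopf (gam t)) = sin psi * (t - i cos psi t^2) + O(t^3)] near the north
    pole: for [psi < PI / 2] the projected curve turns clockwise, whereas
    [a_s 0 psi > 0] and the Lorentz force of [area_form] is the counterclockwise
    quarter turn. *)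
Definition a_s (s psi : R) : R := two_over_tan (Arg (C_vec s psi)).

(** For [(s, psi) = (2, 0)] the projected curve is a point although
    [r_s 2 0 = PI / 4]. *)
Definition r_s (s psi : R) : R := / 2 * Arg (C_vec s psi).

(* Main.v *)
Require Import Defs.
From Stdlib Require Import Reals Lra.
From Coquelicot Require Import Coquelicot.
Open Scope R_scope.

(** Write [c = cos psi].  On the three-sphere the Lorentz force of [s * d alpha]
    is the tangential part of the multiplication by [s i], so that the equation of [gam]
    becomes linear, [gam'' = s i gam' + (s c - 1) gam]
    ([acceleration_formula]).

    The Hopf map is quadratic; its derivative is its polarization [hopf_polar].  Hence
    the first two derivatives of [h = hopf (gam)] are bilinear in [gam] and [gam'],
    and three polynomial identities, valid in all of [C^2], rewrite them in terms of [h],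
    [h'] and the vector product of three-space:
    [|h'|^2 = sin^2 psi] and [h'' = - 4 |h'|^2 h + 2 b h x h'] with [b = s - 2 c]
    ([hopf_projection]).  Since the Lorentz force of [area_form] at [h] is the
    quarter turn [2 h x _], this is the equation of a magnetic geodesic of
    [b * area_form] of speed [sin psi].  Rescaling time by [/ sin psi] gives unit
    speed and the strength [b / sin psi = - a_s].

    The equation for [h] has the conserved vector [M = h x h' + (b / 2) h], and
    [h' = 4 M x h]: the projected point rotates about the axis [M] with angular velocity
    [om = 4 |M| = sqrt (b^2 + 4 sin^2 psi) = 2 |C_s (psi)|], and so it sweeps the whole
    circle in which a plane orthogonal to [M] meets the sphere
    ([magnetic_equation_circle], [orbit_of_rotation]).  As seen from
    [p = - 2 M / om] this circle is at the angle whose cosine is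
    [- b / om = cos (Arg (C_s (psi)))].  Only for [(s, psi) = (2, 0)] is [om] zero.

    It remains to see that Riemannian distance on a round sphere is radius times angle
    ([sphere_dist_acos]).  The great circle arc realizes this value.  Along any curve the
    angle to the starting point grows at most as fast as arc length divided by the
    radius, by a Gram determinant inequality; as [acos] is not differentiable at the ends
    of its domain, this is done for [acos (k * _)] with [k < 1], letting [k] tend to
    [1]. *)

(** * Derivatives of curves componentwise *)

Lemma is_derive_linear_image {U V : NormedModule R_AbsRing} (l : U -> V)
    (f : R -> U) (t : R) (df : U) :
  is_linear l -> is_derive f t df -> is_derive (fun x => l (f x)) t (l df).
Proof.
  intros Hl Hf.
  assert (H := filterdiff_comp' f l t _ l Hf (filterdiff_linear l Hl)).
  apply (filterdiff_ext_lin _ (fun y : R => l (@scal R_AbsRing U y df))); [exact H|].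
  intros y; apply (linear_scal l Hl).
Qed.

Lemma is_derive_pair {U V : NormedModule R_AbsRing} (f : R -> U) (g : R -> V)
    (t : R) (w : U * V) :
  @is_derive R_AbsRing (prod_NormedModule R_AbsRing U V) (fun x => (f x, g x)) t w <->
  is_derive f t (fst w) /\ is_derive g t (snd w).
Proof.
  split.
  - intros H; split.
    + exact (is_derive_linear_image (U := prod_NormedModule R_AbsRing U V)
        fst _ t w is_linear_fst H).
    + exact (is_derive_linear_image (U := prod_NormedModule R_AbsRing U V)
        snd _ t w is_linear_snd H).
  - intros [Hf Hg].
    assert (Hl := is_derive_linear_image (V := prod_NormedModule R_AbsRing U V)
      (fun x : U => (x, zero)) f t (fst w)
      (is_linear_prod _ _ is_linear_id is_linear_zero) Hf).
    assert (Hr := is_derive_linear_image (V := prod_NormedModule R_AbsRing U V)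
      (fun x : V => (zero, x)) g t (snd w)
      (is_linear_prod _ _ is_linear_zero is_linear_id) Hg).
    assert (H := is_derive_plus _ _ _ _ _ Hl Hr).
    assert (E : forall (x : U) (y : V),
      @plus (prod_NormedModule R_AbsRing U V) (x, zero) (zero, y) = (x, y)).
    { intros x y. change ((plus x zero, plus zero y) = (x, y)).
      now rewrite plus_zero_r, plus_zero_l. }
    rewrite E in H. destruct w as [w1 w2].
    refine (is_derive_ext _ _ _ _ _ H). intros x. apply E.
Qed.

Lemma is_derive_C (g : R -> C) (t : R) (w : C) :
  @is_derive R_AbsRing C_R_NormedModule g t w <->
  is_derive (fun x => Re (g x)) t (Re w) /\ is_derive (fun x => Im (g x)) t (Im w).
Proof.
  etransitivity;
    [|exact (is_derive_pair (U := R_NormedModule) (V := R_NormedModule) _ _ t w)].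
  split; apply is_derive_ext; intros x; now destruct (g x).
Qed.

Lemma is_derive_C2 (f : R -> C2) (t : R) (v : C2) :
  is_derive f t v <->
  (is_derive (fun x => Re (fst (f x))) t (Re (fst v)) /\
   is_derive (fun x => Im (fst (f x))) t (Im (fst v))) /\
  (is_derive (fun x => Re (snd (f x))) t (Re (snd v)) /\
   is_derive (fun x => Im (snd (f x))) t (Im (snd v))).
Proof.
  assert (E : is_derive f t v <-> is_derive (fun x => (fst (f x), snd (f x)) : C2) t v).
  { split; apply is_derive_ext; intros x; now destruct (f x). }
  rewrite E.
  etransitivity;
    [exact (is_derive_pair (U := C_R_NormedModule) (V := C_R_NormedModule) _ _ t v)|].
  now rewrite !is_derive_C.
Qed.

Lemma is_derive_CR (f : R -> CR) (t : R) (v : CR) :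
  is_derive f t v <->
  (is_derive (fun x => Re (fst (f x))) t (Re (fst v)) /\
   is_derive (fun x => Im (fst (f x))) t (Im (fst v))) /\
  is_derive (fun x => snd (f x)) t (snd v).
Proof.
  assert (E : is_derive f t v <-> is_derive (fun x => (fst (f x), snd (f x)) : CR) t v).
  { split; apply is_derive_ext; intros x; now destruct (f x). }
  rewrite E.
  etransitivity;
    [exact (is_derive_pair (U := C_R_NormedModule) (V := R_NormedModule) _ _ t v)|].
  now rewrite is_derive_C.
Qed.

Lemma is_derive_triple (f g h : R -> R) (t : R) (v : CR) :
  is_derive f t (Re (fst v)) -> is_derive g t (Im (fst v)) -> is_derive h t (snd v) ->
  is_derive (fun x => ((f x, g x), h x) : CR) t v.
Proof. intros Hf Hg Hh. apply is_derive_CR. now split; [split|]. Qed.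

Lemma is_derive_unique_C2 (f : R -> C2) (t : R) (v w : C2) :
  is_derive f t v -> is_derive f t w -> v = w.
Proof.
  intros [[H1 H2] [H3 H4]]%is_derive_C2 [[G1 G2] [G3 G4]]%is_derive_C2.
  apply is_derive_unique in H1, H2, H3, H4, G1, G2, G3, G4.
  rewrite H1 in G1; rewrite H2 in G2; rewrite H3 in G3; rewrite H4 in G4.
  destruct v as [[? ?] [? ?]], w as [[? ?] [? ?]]; simpl in *; now subst.
Qed.

Lemma constant_of_derivative_zero {V : NormedModule R_AbsRing} (f : R -> V) :
  (forall t, is_derive f t zero) -> forall t, f t = f 0.
Proof.
  intros H t. destruct (Rtotal_order t 0) as [Ht|[->|Ht]]; [|easy|].
  - now apply (eq_is_derive f t 0).
  - symmetry. now apply (eq_is_derive f 0 t).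
Qed.

(** * Vector algebra in three-space and the polarized Hopf map *)

(** The polar form [hopf (z + w) - hopf z - hopf w] of the quadratic map [hopf], which is
    also the differential of [hopf] at [z] applied to [w]. *)
Definition hopf_polar (z w : C2) : CR :=
  ((Cconj (fst z) * snd w + Cconj (fst w) * snd z)%C,
   Re (fst z) * Re (fst w) + Im (fst z) * Im (fst w)
   - Re (snd z) * Re (snd w) - Im (snd z) * Im (snd w)).

Definition cross (p q : CR) : CR :=
  ((Im (fst p) * snd q - snd p * Im (fst q),
    snd p * Re (fst q) - Re (fst p) * snd q),
   Re (fst p) * Im (fst q) - Im (fst p) * Re (fst q)).

(** Reduces an identity between scalars, or between components of vectors, to a real
    one in the coordinates of the vectors of the context.  The last steps replace the
    operations of the module structure on [R], which [simpl] leaves behind, by those of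
    [R]; otherwise [ring] would not recognize them. *)
Ltac coordinates :=
  repeat match goal with
  | x : NormedModule.sort _ C2 |- _ => destruct x as [[? ?] [? ?]]
  | x : NormedModule.sort _ CR |- _ => destruct x as [[? ?] ?]
  | x : C |- _ => destruct x as [? ?]
  end;
  cbv [gCR gC2 herm mul_i hopf hopf_polar cross det3 alpha area_form scale_form
    tangent on_sphere cov_accel minus Cmult Cplus Cconj Ci Re Im] in *;
  simpl in *;
  repeat match goal with
  | |- context [@plus ?G ?a ?b] => change (@plus G a b) with (Rplus a b)
  | |- context [@mult ?G ?a ?b] => change (@mult G a b) with (Rmult a b)
  | |- context [@scal ?K ?G ?a ?b] => change (@scal K G a b) with (Rmult a b)
  | |- context [@opp ?G ?a] => change (@opp G a) with (Ropp a)
  | |- context [@zero ?G] => change (@zero G) with (IZR 0)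
  end;
  try match goal with |- @eq _ ?a ?b => change (@eq R a b) end.

Lemma CR_ext (p q : CR) :
  Re (fst p) = Re (fst q) -> Im (fst p) = Im (fst q) -> snd p = snd q -> p = q.
Proof. destruct p as [[a b] c], q as [[d e] f]; simpl; intros; subst; easy. Qed.

Lemma gC2_sym (u v : C2) : gC2 u v = gC2 v u.
Proof. coordinates; ring. Qed.

Lemma gC2_pos_def (v : C2) : gC2 v v = 0 -> v = zero.
Proof.
  destruct v as [[x1 y1] [x2 y2]]. intros H. coordinates.
  assert (x1 = 0) by nra. assert (y1 = 0) by nra.
  assert (x2 = 0) by nra. assert (y2 = 0) by nra. now subst.
Qed.

Lemma gCR_sym (p q : CR) : gCR p q = gCR q p.
Proof. coordinates; ring. Qed.

Lemma gCR_plus_r (p q r : CR) : gCR p (plus q r) = gCR p q + gCR p r.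
Proof. coordinates; ring. Qed.

Lemma gCR_scal_r (k : R) (p q : CR) : gCR p (scal k q) = k * gCR p q.
Proof. coordinates; ring. Qed.

Lemma gCR_plus_l (p q r : CR) : gCR (plus p q) r = gCR p r + gCR q r.
Proof. coordinates; ring. Qed.

Lemma gCR_scal_l (k : R) (p q : CR) : gCR (scal k p) q = k * gCR p q.
Proof. coordinates; ring. Qed.

Lemma gCR_nonneg (p : CR) : 0 <= gCR p p.
Proof. coordinates; nra. Qed.

Lemma gCR_pos_def (p : CR) : gCR p p = 0 -> p = zero.
Proof.
  destruct p as [[x y] z]. intros H. coordinates.
  assert (x = 0) by nra. assert (y = 0) by nra. assert (z = 0) by nra. now subst.
Qed.

Lemma cross_perp_l (p q : CR) : gCR p (cross p q) = 0.
Proof. coordinates; ring. Qed.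

Lemma cross_perp_r (p q : CR) : gCR q (cross p q) = 0.
Proof. coordinates; ring. Qed.

Lemma cross_cross (p q : CR) :
  cross p (cross p q) = plus (scal (gCR p q) p) (scal (- gCR p p) q).
Proof. apply CR_ext; coordinates; ring. Qed.

Lemma cross_norm (p q : CR) :
  gCR (cross p q) (cross p q) = gCR p p * gCR q q - gCR p q ^ 2.
Proof. coordinates; ring. Qed.

Lemma cross_scal_r (k : R) (p q : CR) : cross p (scal k q) = scal k (cross p q).
Proof. apply CR_ext; coordinates; ring. Qed.

Lemma cross_plus_r (p q r : CR) : cross p (plus q r) = plus (cross p q) (cross p r).
Proof. apply CR_ext; coordinates; ring. Qed.

Lemma cross_diag (p : CR) : cross p p = zero.
Proof. apply CR_ext; coordinates; ring. Qed.

(** The difference of both sides is the Gram determinant of [p], [c], [v], which is the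
    square of [det3 p c v].  It bounds the part of [v] in the direction in which the angle to
    [p] changes. *)
Lemma gram_inequality (p c v : CR) :
  gCR c v = 0 ->
  gCR c c * gCR p v ^ 2 <= (gCR p p * gCR c c - gCR p c ^ 2) * gCR v v.
Proof.
  intros H.
  assert (E : (gCR p p * gCR c c - gCR p c ^ 2) * gCR v v
    - gCR c c * gCR p v ^ 2 = det3 p c v ^ 2
    + gCR c v * (gCR p p * gCR c v - 2 * gCR p c * gCR p v)).
  { clear H. coordinates; ring. }
  rewrite H in E. assert (0 <= det3 p c v ^ 2) by apply pow2_ge_0. lra.
Qed.

(** In the plane orthogonal to [nu] the vectors [d] and [cross nu d] form an orthogonal
    basis.  Both sides are multiplied by [gCR nu nu * gCR d d], so that no vector has to be
    nonzero. *)
Lemma orthogonal_decomposition (nu d e : CR) :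
  gCR nu d = 0 -> gCR nu e = 0 ->
  scal (gCR nu nu * gCR d d) e =
  plus (scal (gCR nu nu * gCR d e) d) (scal (gCR (cross nu d) e) (cross nu d)).
Proof.
  intros Hd He.
  assert (G : scal (gCR (cross nu d) (cross nu d)) e =
    plus (plus (scal (gCR nu nu * gCR d e - gCR nu d * gCR nu e) d)
               (scal (gCR (cross nu d) e) (cross nu d)))
         (scal (gCR d d * gCR nu e - gCR nu d * gCR d e) nu)).
  { clear. apply CR_ext; coordinates; ring. }
  rewrite cross_norm, Hd, He in G.
  replace (gCR nu nu * gCR d d) with (gCR nu nu * gCR d d - 0 ^ 2) by ring.
  rewrite G.
  generalize (cross nu d) (gCR (cross nu d) e) (gCR nu nu) (gCR d d) (gCR d e).
  clear; intros.
  apply CR_ext; coordinates; ring.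
Qed.

Lemma Cmod_sqr (z : C) : Cmod z ^ 2 = Re z ^ 2 + Im z ^ 2.
Proof. unfold Cmod. rewrite pow2_sqrt; [easy|]. unfold Re, Im; nra. Qed.

Lemma hopf_polarization (z : C2) : hopf z = scal (/ 2) (hopf_polar z z).
Proof.
  unfold hopf; rewrite !Cmod_sqr.
  apply CR_ext; coordinates; field.
Qed.

Lemma hopf_norm (z : C2) : gCR (hopf z) (hopf z) = (/ 2) ^ 2 * gC2 z z ^ 2.
Proof. rewrite hopf_polarization. coordinates; field. Qed.

(** For a unit vector [z] the differential of [hopf] carries the quarter turn of the plane
    complex-orthogonal to [z] to the quarter turn [2 hopf z x _] of the tangent plane at
    [hopf z].  The last term corrects for the component of [u] along the fibre direction
    [mul_i z]. *)
Lemma hopf_cross_polar (z u : C2) :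
  scal 2 (cross (hopf z) (hopf_polar z u))
  = plus (scal (gC2 z z) (hopf_polar z (mul_i u))) (scal (2 * gC2 (mul_i z) u) (hopf z)).
Proof.
  rewrite !hopf_polarization. apply CR_ext; coordinates; field.
Qed.

(** For [z], [u] orthonormal, with [u] the sum of a fibre component [c i z] and a vector
    [n] complex-orthogonal to [z]: the quadratic map [hopf] takes [i z] to [hopf z] and [n]
    to a negative multiple of [hopf z], and the mixed term is a multiple of the
    differential at [z] applied to [i n].  The factors [gC2 z z], [gC2 u u],
    [gC2 z u] make this an identity for all [z], [u]. *)
Lemma hopf_tangent_vector (z u : C2) :
  scal (gC2 z z) (hopf u)
  = plus (plus (scal (- gC2 (mul_i z) u) (hopf_polar z (mul_i u)))
     (scal (- gC2 u u) (hopf z))) (scal (gC2 z u) (hopf_polar z u)).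
Proof.
  rewrite !hopf_polarization. apply CR_ext; coordinates; field.
Qed.

(** The Hopf map is a Riemannian submersion whose fibre direction is [mul_i z]. *)
Lemma hopf_polar_norm (z u : C2) :
  gCR (hopf_polar z u) (hopf_polar z u) = gC2 z z * gC2 u u - gC2 (mul_i z) u ^ 2.
Proof.
  coordinates; field.
Qed.

(** * Product rules *)

Lemma is_derive_Rmult (f g : R -> R) (t df dg : R) :
  is_derive f t df -> is_derive g t dg ->
  is_derive (fun x => f x * g x) t (df * g t + f t * dg).
Proof. intros Hf Hg. exact (is_derive_mult f g t df dg Hf Hg Rmult_comm). Qed.

Lemma is_derive_Rplus (f g : R -> R) (t df dg : R) :
  is_derive f t df -> is_derive g t dg ->
  is_derive (fun x => f x + g x) t (df + dg).
Proof. intros Hf Hg. exact (is_derive_plus f g t df dg Hf Hg). Qed.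

Lemma is_derive_Rminus (f g : R -> R) (t df dg : R) :
  is_derive f t df -> is_derive g t dg ->
  is_derive (fun x => f x - g x) t (df - dg).
Proof. intros Hf Hg. exact (is_derive_minus f g t df dg Hf Hg). Qed.

(** Differentiates a polynomial in functions whose derivatives are in the context.  The
    rule is chosen by the head symbol, so that a component such as [Re (fst (f x))]
    is an atom. *)
Ltac derive_polynomial :=
  evar_last;
  [ repeat lazymatch goal with
    | |- is_derive (fun x => _ + _) _ _ => apply is_derive_Rplus
    | |- is_derive (fun x => _ - _) _ _ => apply is_derive_Rminus
    | |- is_derive (fun x => _ * _) _ _ => apply is_derive_Rmult
    | |- is_derive _ _ _ => eassumption
    end
  | cbv beta ].

Lemma is_derive_gC2 (f g : R -> C2) (t : R) (df dg : C2) :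
  is_derive f t df -> is_derive g t dg ->
  is_derive (fun x => gC2 (f x) (g x)) t (gC2 df (g t) + gC2 (f t) dg).
Proof.
  intros [[Hf1 Hf2] [Hf3 Hf4]]%is_derive_C2 [[Hg1 Hg2] [Hg3 Hg4]]%is_derive_C2.
  apply (is_derive_ext (fun x =>
    Re (fst (f x)) * Re (fst (g x)) + Im (fst (f x)) * Im (fst (g x)) +
    Re (snd (f x)) * Re (snd (g x)) + Im (snd (f x)) * Im (snd (g x)))).
  { intros x. generalize (f x) (g x); intros z w; coordinates; ring. }
  derive_polynomial.
  clear. generalize (f t) (g t); intros z w; coordinates; ring.
Qed.

Lemma is_derive_gCR (f g : R -> CR) (t : R) (df dg : CR) :
  is_derive f t df -> is_derive g t dg ->
  is_derive (fun x => gCR (f x) (g x)) t (gCR df (g t) + gCR (f t) dg).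
Proof.
  intros [[Hf1 Hf2] Hf3]%is_derive_CR [[Hg1 Hg2] Hg3]%is_derive_CR.
  apply (is_derive_ext (fun x =>
    Re (fst (f x)) * Re (fst (g x)) + Im (fst (f x)) * Im (fst (g x)) +
    snd (f x) * snd (g x))).
  { intros x. generalize (f x) (g x); intros z w; coordinates; ring. }
  derive_polynomial.
  clear. generalize (f t) (g t); intros z w; coordinates; ring.
Qed.

Lemma continuous_gCR (f g : R -> CR) (t : R) :
  continuous f t -> continuous g t -> continuous (fun x => gCR (f x) (g x)) t.
Proof.
  assert (C1 : forall p : CR, continuous (fun p : CR => Re (fst p)) p).
  { intros p. apply (linear_cont (U := CR) (V := R_NormedModule) (fun p : CR => Re (fst p))).
    exact (is_linear_comp (U := CR) (V := C_R_NormedModule) (W := R_NormedModule)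
      fst fst is_linear_fst is_linear_fst). }
  assert (C2 : forall p : CR, continuous (fun p : CR => Im (fst p)) p).
  { intros p. apply (linear_cont (U := CR) (V := R_NormedModule) (fun p : CR => Im (fst p))).
    exact (is_linear_comp (U := CR) (V := C_R_NormedModule) (W := R_NormedModule)
      fst snd is_linear_fst is_linear_snd). }
  assert (C3 : forall p : CR, continuous (fun p : CR => snd p) p).
  { intros p. apply (linear_cont (U := CR) (V := R_NormedModule) (fun p : CR => snd p)).
    exact (is_linear_snd (U := C_R_NormedModule) (V := R_NormedModule)). }
  intros Hf Hg.
  apply (continuous_ext (fun x =>
    Re (fst (f x)) * Re (fst (g x)) + Im (fst (f x)) * Im (fst (g x)) +
    snd (f x) * snd (g x))).
  { intros x. generalize (f x) (g x); intros z w; coordinates; ring. }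
  apply (continuous_plus (V := R_NormedModule)
    (fun x => Re (fst (f x)) * Re (fst (g x)) + Im (fst (f x)) * Im (fst (g x)))
    (fun x => snd (f x) * snd (g x)));
    [apply (continuous_plus (V := R_NormedModule)
      (fun x => Re (fst (f x)) * Re (fst (g x)))
      (fun x => Im (fst (f x)) * Im (fst (g x))))|];
    apply (continuous_mult (K := R_AbsRing)).
  - exact (continuous_comp f _ t Hf (C1 _)).
  - exact (continuous_comp g _ t Hg (C1 _)).
  - exact (continuous_comp f _ t Hf (C2 _)).
  - exact (continuous_comp g _ t Hg (C2 _)).
  - exact (continuous_comp f _ t Hf (C3 _)).
  - exact (continuous_comp g _ t Hg (C3 _)).
Qed.

Lemma is_derive_cross (f g : R -> CR) (t : R) (df dg : CR) :
  is_derive f t df -> is_derive g t dg ->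
  is_derive (fun x => cross (f x) (g x)) t (plus (cross df (g t)) (cross (f t) dg)).
Proof.
  intros [[Hf1 Hf2] Hf3]%is_derive_CR [[Hg1 Hg2] Hg3]%is_derive_CR.
  apply is_derive_triple; derive_polynomial; clear;
    generalize (f t) (g t); intros z w; coordinates; ring.
Qed.

Lemma is_derive_hopf_polar (f g : R -> C2) (t : R) (df dg : C2) :
  is_derive f t df -> is_derive g t dg ->
  is_derive (fun x => hopf_polar (f x) (g x)) t
    (plus (hopf_polar df (g t)) (hopf_polar (f t) dg)).
Proof.
  intros [[Hf1 Hf2] [Hf3 Hf4]]%is_derive_C2 [[Hg1 Hg2] [Hg3 Hg4]]%is_derive_C2.
  apply (is_derive_ext (fun x =>
   ((Re (fst (f x)) * Re (snd (g x)) + Im (fst (f x)) * Im (snd (g x)) +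
     (Re (fst (g x)) * Re (snd (f x)) + Im (fst (g x)) * Im (snd (f x))),
     Re (fst (f x)) * Im (snd (g x)) - Im (fst (f x)) * Re (snd (g x)) +
     (Re (fst (g x)) * Im (snd (f x)) - Im (fst (g x)) * Re (snd (f x)))),
    Re (fst (f x)) * Re (fst (g x)) + Im (fst (f x)) * Im (fst (g x))
    - Re (snd (f x)) * Re (snd (g x)) - Im (snd (f x)) * Im (snd (g x))) : CR)).
  { intros x. generalize (f x) (g x); intros z w; apply CR_ext; coordinates; ring. }
  apply is_derive_triple; derive_polynomial; clear;
    generalize (f t) (g t); intros z w; coordinates; ring.
Qed.

Lemma is_derive_hopf (f : R -> C2) (t : R) (df : C2) :
  is_derive f t df -> is_derive (fun x => hopf (f x)) t (hopf_polar (f t) df).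
Proof.
  intros Hf.
  apply (is_derive_ext (fun x => scal (/ 2) (hopf_polar (f x) (f x)))).
  { intros x. now rewrite hopf_polarization. }
  assert (H := is_derive_linear_image (scal (/ 2)) _ _ _
    (is_linear_scal_r (K := R_AbsRing) (V := CR) (/ 2) Rmult_comm)
    (is_derive_hopf_polar _ _ _ _ _ Hf Hf)).
  evar_last; [exact H|].
  clear. generalize (f t); intros z. apply CR_ext; coordinates; field.
Qed.

(** * Magnetic geodesics of the three-sphere *)

Lemma ext_deriv_alpha (p u v : C2) : ext_deriv alpha p u v = gC2 (mul_i u) v.
Proof.
  unfold ext_deriv.
  assert (E : forall a b : C2, Derive (fun t : R => alpha (plus p (scal t a)) b) 0
     = / 2 * gC2 (mul_i a) b).
  { intros a b. apply is_derive_unique.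
    apply (is_derive_ext (fun t => / 2 * gC2 (mul_i p) b + t * (/ 2 * gC2 (mul_i a) b))).
    { intros t; coordinates; ring. }
    auto_derive; [easy|ring]. }
  rewrite !E. coordinates. field.
Qed.

(** Unit speed magnetic geodesics of [s * d alpha] with contact angle of cosine [c],
    with the derivatives made explicit: [has_speed] and [contact_angle] provide a
    derivative at each time separately. *)
Record contact_magnetic_geodesic (s c : R) (gam gam' gam'' : R -> C2) : Prop := {
  cmg_sphere : forall t, gC2 (gam t) (gam t) = 1;
  cmg_velocity : forall t, is_derive gam t (gam' t);
  cmg_acceleration : forall t, is_derive gam' t (gam'' t);
  cmg_lorentz : forall t,
    is_lorentz_force gC2 (scale_form s (ext_deriv alpha)) (gam t) (gam' t)
      (cov_accel gC2 (gam t) (gam'' t));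
  cmg_unit_speed : forall t, gC2 (gam' t) (gam' t) = 1;
  cmg_contact : forall t, gC2 (mul_i (gam t)) (gam' t) = c }.

Lemma contact_magnetic_geodesic_of_curve (s psi : R) (gam : R -> C2) :
  is_magnetic_geodesic gC2 1 (scale_form s (ext_deriv alpha)) gam ->
  has_speed gC2 gam 1 -> contact_angle gam psi ->
  exists gam' gam'', contact_magnetic_geodesic s (cos psi) gam gam' gam''.
Proof.
  intros [Hs (gam' & gam'' & D1 & D2 & HL)] Hv [_ Hc].
  exists gam', gam''. split; try easy.
  - intros t. rewrite (Hs t). ring.
  - intros t. destruct (Hv t) as [v [Dv Ev]].
    rewrite (is_derive_unique_C2 _ _ _ _ Dv (D1 t)) in Ev.
    assert (Hn : 0 <= gC2 (gam' t) (gam' t))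
      by (destruct (gam' t) as [[x1 y1] [x2 y2]]; coordinates; nra).
    rewrite <- (sqrt_sqrt _ Hn), Ev. ring.
  - intros t. destruct (Hc t) as [v [Dv Ev]].
    now rewrite (is_derive_unique_C2 _ _ _ _ Dv (D1 t)) in Ev.
Qed.

Lemma velocity_tangent (s c : R) (gam gam' gam'' : R -> C2) :
  contact_magnetic_geodesic s c gam gam' gam'' ->
  forall t, gC2 (gam t) (gam' t) = 0.
Proof.
  intros H t.
  assert (D := is_derive_gC2 _ _ _ _ _ (cmg_velocity _ _ _ _ _ H t)
    (cmg_velocity _ _ _ _ _ H t)).
  apply (is_derive_ext _ (fun _ => 1)) in D; [|exact (cmg_sphere _ _ _ _ _ H)].
  apply is_derive_unique in D. rewrite Derive_const, (gC2_sym (gam' t)) in D. lra.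
Qed.

(** Differentiate [gC2 gam gam' = 0]. *)
Lemma radial_acceleration (s c : R) (gam gam' gam'' : R -> C2) :
  contact_magnetic_geodesic s c gam gam' gam'' ->
  forall t, gC2 (gam t) (gam'' t) = - 1.
Proof.
  intros H t.
  assert (D := is_derive_gC2 _ _ _ _ _ (cmg_velocity _ _ _ _ _ H t)
    (cmg_acceleration _ _ _ _ _ H t)).
  apply (is_derive_ext _ (fun _ => 0)) in D; [|exact (velocity_tangent _ _ _ _ _ H)].
  apply is_derive_unique in D.
  rewrite Derive_const, (cmg_unit_speed _ _ _ _ _ H) in D. lra.
Qed.

(** The tangent vector representing [s * d alpha (u, _)] is the tangential part
    [s (i u + c z)] of [s i u]; the radial part of the acceleration is [- z]. *)
Lemma acceleration_formula (s c : R) (gam gam' gam'' : R -> C2) :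
  contact_magnetic_geodesic s c gam gam' gam'' ->
  forall t, gam'' t = plus (scal s (mul_i (gam' t))) (scal (s * c - 1) (gam t)).
Proof.
  intros H t.
  assert (Ha := radial_acceleration _ _ _ _ _ H t).
  destruct H as [Hz _ _ Hl _ Hc]. specialize (Hz t). specialize (Hc t).
  destruct (Hl t) as [_ Hforce].
  revert Hz Hc Ha Hforce. unfold scale_form, cov_accel.
  generalize (gam t) (gam' t) (gam'' t); clear; intros z u a Hz Hc Ha Hforce.
  (* The difference [d] of both sides is tangent, so it may be fed to the Lorentz
     force identity; this gives [gC2 d d = 0]. *)
  set (d := minus a (plus (scal s (mul_i u)) (scal (s * c - 1) z))).
  assert (Hd : gC2 z d = 0).
  { transitivity (gC2 z a + s * gC2 (mul_i z) u - (s * c - 1) * gC2 z z).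
    - unfold d. clear. coordinates; ring.
    - rewrite Ha, Hc, Hz. ring. }
  assert (F := Hforce d Hd). rewrite ext_deriv_alpha, Ha, Hz in F.
  assert (Hdd : gC2 d d = 0).
  { transitivity (gC2 (minus a (scal (-1 / 1) z)) d
      - s * gC2 (mul_i u) d - s * c * gC2 z d).
    - unfold d at 1. generalize d; clear; intros e. coordinates; field.
    - rewrite F, Hd. ring. }
  apply gC2_pos_def in Hdd.
  apply (plus_reg_r (opp (plus (scal s (mul_i u)) (scal (s * c - 1) z)))).
  rewrite plus_opp_r. exact Hdd.
Qed.

(** * The projected curve *)

(** The equation of a magnetic geodesic of [b * area_form] with speed [sqrt k], written in
    the ambient space: the radial acceleration is [- 4 k h] on a sphere of radius [/ 2], and
    [2 (h x _)] is the quarter turn of the tangent plane at [h]. *)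
Definition magnetic_equation (b k : R) (h h' : R -> CR) : Prop :=
  (forall t, on_sphere gCR (/ 2) (h t)) /\
  (forall t, is_derive h t (h' t)) /\
  (forall t, gCR (h' t) (h' t) = k) /\
  (forall t, is_derive h' t
     (plus (scal (- 4 * k) (h t)) (scal (2 * b) (cross (h t) (h' t))))).

(** In [h'' = hopf_polar gam gam'' + 2 hopf gam'] insert the linear equation of [gam]; then
    [hopf_tangent_vector] and [hopf_cross_polar] eliminate [hopf gam'] and
    [hopf_polar gam (i gam')]. *)
Lemma hopf_projection (s c : R) (gam gam' gam'' : R -> C2) :
  contact_magnetic_geodesic s c gam gam' gam'' ->
  magnetic_equation (s - 2 * c) (1 - c ^ 2)
    (fun t => hopf (gam t)) (fun t => hopf_polar (gam t) (gam' t)).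
Proof.
  intros H.
  assert (Ht := velocity_tangent _ _ _ _ _ H).
  assert (Ha := acceleration_formula _ _ _ _ _ H).
  destruct H as [Hz D1 D2 _ Hu Hc].
  repeat apply conj; intros t.
  - unfold on_sphere. rewrite hopf_norm, Hz. ring.
  - now apply is_derive_hopf.
  - rewrite hopf_polar_norm, Hz, Hu, Hc. ring.
  - evar_last; [exact (is_derive_hopf_polar _ _ _ _ _ (D1 t) (D2 t))|].
    rewrite Ha.
    assert (Hx := hopf_cross_polar (gam t) (gam' t)).
    assert (Hv := hopf_tangent_vector (gam t) (gam' t)).
    rewrite Hz, Hc in Hx. rewrite Hz, Hc, Hu, Ht in Hv.
    revert Hx Hv. generalize (gam t) (gam' t); clear; intros z u Hx Hv.
    replace (2 * (s - 2 * c)) with ((s - 2 * c) * 2) by ring.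
    rewrite <- (scal_assoc (s - 2 * c) 2), Hx.
    (* [hopf_polar u u = 2 hopf u], and [hopf_polar z] is applied to the formula
       for the acceleration *)
    transitivity (plus (scal 2 (scal 1 (hopf u)))
      (plus (scal s (hopf_polar z (mul_i u))) (scal (2 * (s * c - 1)) (hopf z)))).
    + rewrite !hopf_polarization; clear; apply CR_ext; coordinates; field.
    + rewrite Hv.
      generalize (hopf z) (hopf_polar z u) (hopf_polar z (mul_i u)); clear; intros.
      apply CR_ext; coordinates; ring.
Qed.

Lemma magnetic_equation_geodesic (b k : R) (h h' : R -> CR) :
  magnetic_equation b k h h' ->
  is_magnetic_geodesic gCR (/ 2) (scale_form b area_form) h /\
  has_speed gCR h (sqrt k).
Proof.
  intros (Hs & D1 & Hk & D2). split.
  - split; [easy|].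
    exists h', (fun t => plus (scal (- 4 * k) (h t)) (scal (2 * b) (cross (h t) (h' t)))).
    split; [easy|split; [easy|]]. intros t.
    assert (E : cov_accel gCR (h t)
        (plus (scal (- 4 * k) (h t)) (scal (2 * b) (cross (h t) (h' t))))
      = scal (2 * b) (cross (h t) (h' t))).
    { unfold cov_accel. rewrite gCR_plus_r, !gCR_scal_r, cross_perp_l, (Hs t).
      generalize (h t) (cross (h t) (h' t)); intros p q.
      apply CR_ext; coordinates; field. }
    rewrite E. split.
    + unfold tangent. rewrite gCR_scal_r, cross_perp_l. ring.
    + intros v _. generalize (h t) (h' t); intros p q. coordinates; ring.
  - intros t. exists (h' t). split; [easy|]. now rewrite Hk.
Qed.

Lemma magnetic_equation_rescale (b k a : R) (h h' : R -> CR) :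
  magnetic_equation b k h h' ->
  magnetic_equation (a * b) (a ^ 2 * k) (fun t => h (a * t)) (fun t => scal a (h' (a * t))).
Proof.
  intros (Hs & D1 & Hk & D2).
  assert (Da : forall t, is_derive (fun x => a * x) t a)
    by (intros t; auto_derive; [easy|ring]).
  repeat apply conj; intros t.
  - apply Hs.
  - exact (is_derive_comp h (fun x => a * x) t _ _ (D1 (a * t)) (Da t)).
  - rewrite gCR_scal_l, gCR_scal_r, Hk. ring.
  - evar_last.
    + exact (is_derive_linear_image (scal a) _ t _
        (is_linear_scal_r (K := R_AbsRing) (V := CR) a Rmult_comm)
        (is_derive_comp h' (fun x => a * x) t _ _ (D2 (a * t)) (Da t))).
    + generalize (h (a * t)) (h' (a * t)); intros p q.
      apply CR_ext; coordinates; ring.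
Qed.

(** The hypothesis is local so that it applies inside the interval on which a curve is known
    to stay on the sphere. *)
Lemma velocity_tangent_to_sphere (rho : R) (c : R -> CR) (t : R) (v : CR) :
  locally t (fun x => on_sphere gCR rho (c x)) -> is_derive c t v -> gCR (c t) v = 0.
Proof.
  intros Hloc Dc.
  assert (H := is_derive_gCR _ _ _ _ _ Dc Dc).
  apply (is_derive_ext_loc _ (fun _ => rho ^ 2)) in H; [|exact Hloc].
  apply is_derive_unique in H. rewrite Derive_const, (gCR_sym v) in H. lra.
Qed.

(** The derivative is [h x h'' + (b / 2) h' = 2 b h x (h x h') + (b / 2) h'], and
    [h x (h x h') = - h' / 4] because [h'] is tangent and [|h|^2 = 1 / 4]. *)
Lemma magnetic_equation_axis (b k : R) (h h' : R -> CR) :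
  magnetic_equation b k h h' ->
  forall t, plus (cross (h t) (h' t)) (scal (b / 2) (h t)) =
    plus (cross (h 0) (h' 0)) (scal (b / 2) (h 0)).
Proof.
  intros (Hs & D1 & Hk & D2).
  assert (Ht : forall t, gCR (h t) (h' t) = 0).
  { intros t. apply (velocity_tangent_to_sphere (/ 2)); [now apply filter_forall|easy]. }
  set (M := fun t => plus (cross (h t) (h' t)) (scal (b / 2) (h t))).
  assert (DM : forall t, is_derive M t zero).
  { intros t. evar_last.
    - exact (is_derive_plus _ _ _ _ _ (is_derive_cross _ _ _ _ _ (D1 t) (D2 t))
        (is_derive_linear_image (scal (b / 2)) _ t _
        (is_linear_scal_r (K := R_AbsRing) (V := CR) (b / 2) Rmult_comm) (D1 t))).
    - rewrite cross_diag, cross_plus_r, !cross_scal_r, cross_diag, cross_cross, Ht, (Hs t).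
      generalize (h t) (h' t); intros p q. apply CR_ext; coordinates; field. }
  intros t. change (M t = M 0).
  now apply constant_of_derivative_zero.
Qed.

(** * Orbits of rotations *)

Lemma rotation_conserves_norm (nu : CR) (h : R -> CR) :
  (forall t, is_derive h t (cross nu (h t))) ->
  forall t, gCR (h t) (h t) = gCR (h 0) (h 0).
Proof.
  intros Dh. apply (constant_of_derivative_zero (V := R_NormedModule)
    (fun t => gCR (h t) (h t))). intros t.
  evar_last; [exact (is_derive_gCR _ _ _ _ _ (Dh t) (Dh t))|].
  rewrite (gCR_sym (cross _ _)), cross_perp_r; apply Rplus_0_r.
Qed.

Lemma rotation_conserves_height (nu : CR) (h : R -> CR) :
  (forall t, is_derive h t (cross nu (h t))) ->
  forall t, gCR nu (h t) = gCR nu (h 0).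
Proof.
  intros Dh. apply (constant_of_derivative_zero (V := R_NormedModule)
    (fun t => gCR nu (h t))). intros t.
  evar_last;
    [exact (is_derive_gCR (fun _ => nu) _ _ _ _ (is_derive_const nu t) (Dh t))|].
  rewrite cross_perp_l, gCR_sym. generalize (h t); intros p; coordinates; ring.
Qed.

(** The difference of two solutions is a solution, and its norm is conserved. *)
Lemma linear_ode_unique (nu : CR) (h k : R -> CR) :
  (forall t, is_derive h t (cross nu (h t))) ->
  (forall t, is_derive k t (cross nu (k t))) ->
  h 0 = k 0 -> forall t, h t = k t.
Proof.
  intros Dh Dk H0 t.
  assert (D : forall t, is_derive (fun x => minus (h x) (k x)) t
    (cross nu (minus (h t) (k t)))).
  { intros x. evar_last; [exact (is_derive_minus _ _ _ _ _ (Dh x) (Dk x))|].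
    generalize (h x) (k x); intros p q; apply CR_ext; coordinates; ring. }
  assert (N := rotation_conserves_norm nu _ D t). cbv beta in N.
  rewrite H0, minus_eq_zero in N.
  assert (Z : minus (h t) (k t) = zero).
  { apply gCR_pos_def. rewrite N. coordinates; ring. }
  apply (plus_reg_r (opp (k t))). now rewrite plus_opp_r.
Qed.

(** Rodrigues' formula for the rotation of [l nu + d] about the axis [nu]. *)
Lemma rodrigues_derive (nu d : CR) (om l : R) :
  om <> 0 -> gCR nu nu = om ^ 2 -> gCR nu d = 0 -> forall t,
  let r t := plus (scal l nu)
    (plus (scal (cos (om * t)) d) (scal (sin (om * t) / om) (cross nu d))) in
  is_derive r t (cross nu (r t)).
Proof.
  intros Hom Hnu Hd t r.
  assert (E : cross nu (r t) =
    plus (scal (- om * sin (om * t)) d) (scal (cos (om * t)) (cross nu d))).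
  { unfold r.
    rewrite !cross_plus_r, !cross_scal_r, cross_diag, cross_cross, Hd, Hnu.
    generalize (cross nu d); intros e; apply CR_ext; coordinates; field; easy. }
  rewrite E. unfold r. clear E r. generalize (cross nu d); clear Hnu Hd; intros e.
  apply (is_derive_ext (fun x =>
    let comb a b c := l * a + (cos (om * x) * b + sin (om * x) / om * c) in
    ((comb (Re (fst nu)) (Re (fst d)) (Re (fst e)),
      comb (Im (fst nu)) (Im (fst d)) (Im (fst e))),
     comb (snd nu) (snd d) (snd e)) : CR)).
  { intros x. apply CR_ext; coordinates; ring. }
  apply is_derive_triple; coordinates; auto_derive; try easy; now field.
Qed.

Lemma unit_circle_angle (x y : R) :
  x ^ 2 + y ^ 2 = 1 -> exists theta, cos theta = x /\ sin theta = y.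
Proof.
  intros H.
  assert (Hx : -1 <= x <= 1) by nra.
  assert (Hs : sqrt (1 - x²) = Rabs y).
  { rewrite <- sqrt_Rsqr_abs; f_equal; unfold Rsqr; lra. }
  destruct (Rle_lt_dec 0 y) as [Hy|Hy].
  - exists (acos x). rewrite cos_acos, sin_acos, Hs, Rabs_pos_eq; easy.
  - exists (- acos x).
    rewrite cos_neg, sin_neg, cos_acos, sin_acos, Hs, Rabs_left; lra.
Qed.

(** The sphere and the plane orthogonal to [nu] through [h 0] meet in a circle, and every
    point of it is reached, since the radius vector [cos (om t) d + sin (om t) (nu x d) / om]
    takes all directions of that plane. *)
Lemma orbit_of_rotation (nu : CR) (om : R) (h : R -> CR) :
  0 < om -> gCR nu nu = om ^ 2 ->
  (forall t, is_derive h t (cross nu (h t))) ->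
  forall q, (exists t, h t = q) <->
    gCR q q = gCR (h 0) (h 0) /\ gCR nu q = gCR nu (h 0).
Proof.
  intros Hom Hnu Dh q. split.
  { intros [t <-]. split.
    - now apply (rotation_conserves_norm nu).
    - now apply rotation_conserves_height. }
  intros [Hq Hnuq].
  (* [scal l nu] is the centre of the circle; [d] and [e] are the radius vectors
     of [h 0] and [q]. *)
  set (l := gCR nu (h 0) / om ^ 2).
  set (d := minus (h 0) (scal l nu)).
  set (e := minus q (scal l nu)).
  assert (perp : forall p, gCR nu p = gCR nu (h 0) -> gCR nu (minus p (scal l nu)) = 0).
  { intros p Hp.
    transitivity (gCR nu p - l * gCR nu nu);
      [generalize l; clear; intros; coordinates; ring|].
    rewrite Hp, Hnu. unfold l. field. lra. }
  assert (Hd : gCR nu d = 0) by now apply perp.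
  assert (He : gCR nu e = 0) by now apply perp.
  assert (Hed : gCR e e = gCR d d).
  { assert (E : forall p, gCR (minus p (scal l nu)) (minus p (scal l nu)) =
       gCR p p - 2 * l * gCR nu p + l ^ 2 * gCR nu nu).
    { generalize l; clear; intros; coordinates; ring. }
    unfold e, d. now rewrite !E, Hq, Hnuq. }
  assert (Hq' : q = plus (scal l nu) e).
  { unfold e; generalize l; clear; intros; apply CR_ext; coordinates; ring. }
  assert (Hh : forall t, h t = plus (scal l nu)
    (plus (scal (cos (om * t)) d) (scal (sin (om * t) / om) (cross nu d)))).
  { apply (linear_ode_unique nu); [easy| |].
    - intros t; apply (rodrigues_derive nu d om l); [lra|easy|easy].
    - rewrite Rmult_0_r, cos_0, sin_0. unfold d.
      generalize (h 0) l; intros p m. clear - Hom. apply CR_ext; coordinates; field; lra. }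
  destruct (Req_dec (gCR d d) 0) as [Hd0|Hd0].
  - (* the orbit is a single point of the axis *)
    exists 0. assert (Ed := gCR_pos_def _ Hd0). rewrite Hd0 in Hed.
    apply gCR_pos_def in Hed. rewrite Hq', Hed, Hh, Ed.
    clear - Hom. generalize l (cos (om * 0)) (sin (om * 0) / om); intros.
    apply CR_ext; coordinates; ring.
  - assert (Dec := orthogonal_decomposition nu d e Hd He).
    assert (Hxy : (gCR d e / gCR d d) ^ 2 + (gCR (cross nu d) e / (om * gCR d d)) ^ 2 = 1).
    { assert (N := f_equal (fun p => gCR p e) Dec). cbv beta in N.
      rewrite gCR_plus_l, !gCR_scal_l, Hed, Hnu in N.
      apply (Rmult_eq_reg_l (om ^ 2 * gCR d d * gCR d d));
        [|repeat apply Rmult_integral_contrapositive_currified; nra].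
      rewrite Rmult_1_r. rewrite N at 2. field. split; [easy|lra]. }
    destruct (unit_circle_angle _ _ Hxy) as [theta [Hc Hs]].
    exists (theta / om). rewrite Hh, Hq'. f_equal.
    replace (om * (theta / om)) with theta by (field; lra).
    rewrite Hc, Hs.
    transitivity (scal (/ (om ^ 2 * gCR d d)) (scal (om ^ 2 * gCR d d) e)).
    + rewrite <- Hnu at 2. rewrite Dec, Hnu.
      revert Hd0. generalize (gCR (cross nu d) e) (gCR d e) (gCR d d) (cross nu d) d.
      clear - Hom. intros. apply CR_ext; coordinates; field; lra.
    + rewrite scal_assoc.
      replace (mult (/ (om ^ 2 * gCR d d)) (om ^ 2 * gCR d d)) with 1; [apply (scal_one e)|].
      change (1 = / (om ^ 2 * gCR d d) * (om ^ 2 * gCR d d)). field; lra.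
Qed.

(** The conserved vector [M] has norm [om / 4] and [gCR M h = b / 8]; from the conservation
    of [M] one gets [h' = 4 M x h].  The centre [p] is the point of the sphere
    opposite to [M]. *)
Lemma magnetic_equation_circle (b k om : R) (h h' : R -> CR) :
  magnetic_equation b k h h' -> 0 < om -> om ^ 2 = b ^ 2 + 4 * k ->
  exists p, on_sphere gCR (/ 2) p /\
    forall q, (exists t, h t = q) <->
      on_sphere gCR (/ 2) q /\ gCR p q = (/ 2) ^ 2 * (- b / om).
Proof.
  intros Hm Hom Eom. assert (Hax := magnetic_equation_axis _ _ _ _ Hm).
  destruct Hm as (Hs & D1 & Hk & _).
  assert (Ht : forall t, gCR (h t) (h' t) = 0).
  { intros t. apply (velocity_tangent_to_sphere (/ 2)); [now apply filter_forall|easy]. }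
  set (M := plus (cross (h 0) (h' 0)) (scal (b / 2) (h 0))) in *.
  assert (HMM : gCR M M = (om / 4) ^ 2).
  { unfold M. rewrite !gCR_plus_r, !gCR_plus_l, !gCR_scal_r, !gCR_scal_l, cross_norm,
      (gCR_sym (cross _ _)), cross_perp_l, Ht, Hk, (Hs 0).
    replace ((om / 4) ^ 2) with (om ^ 2 / 16) by field. rewrite Eom. field. }
  assert (HMh : gCR M (h 0) = b / 8).
  { unfold M.
    rewrite gCR_plus_l, gCR_scal_l, (gCR_sym (cross _ _)), cross_perp_l, (Hs 0). field. }
  assert (Dh : forall t, is_derive h t (cross (scal 4 M) (h t))).
  { intros t. evar_last; [exact (D1 t)|]. rewrite <- (Hax t).
    transitivity (plus (scal (4 * gCR (h t) (h t)) (h' t))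
      (scal (- 4 * gCR (h t) (h' t)) (h t))).
    - rewrite Ht, (Hs t). generalize (h t) (h' t); intros p q.
      apply CR_ext; coordinates; field.
    - (* expansion of the triple product [cross (cross h h') h] *)
      generalize (h t) (h' t); intros p q. apply CR_ext; coordinates; field. }
  exists (scal (- 2 / om) M). split.
  - unfold on_sphere. rewrite gCR_scal_l, gCR_scal_r, HMM. field. lra.
  - intros q.
    rewrite (orbit_of_rotation (scal 4 M) om h Hom);
      [|rewrite gCR_scal_l, gCR_scal_r, HMM; field|easy].
    rewrite !gCR_scal_l, HMh, (Hs 0). unfold on_sphere.
    split; intros [Hq Hp]; split; try easy.
    + replace (gCR M q) with (b / 8) by lra. field; lra.
    + apply (Rmult_eq_reg_l (2 / (4 * om)));
        [|now apply Rgt_not_eq, Rdiv_lt_0_compat; lra].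
      replace (2 / (4 * om) * (4 * gCR M q)) with (- (- 2 / om * gCR M q)) by (field; lra).
      rewrite Hp. field; lra.
Qed.

(** * Riemannian distance on the round sphere *)

Lemma is_derive_acos (x : R) : -1 < x < 1 -> is_derive acos x (- / sqrt (1 - x ^ 2)).
Proof.
  intros Hx. apply is_derive_Reals.
  replace (- / sqrt (1 - x ^ 2)) with (derive_pt acos x (derivable_pt_acos x Hx)).
  - apply derive_pt_eq_1 with (derivable_pt_acos x Hx). reflexivity.
  - rewrite derive_pt_acos. replace x² with (x ^ 2) by (unfold Rsqr; ring).
    field. apply Rgt_not_eq, sqrt_lt_R0. nra.
Qed.

Lemma sphere_gCR_bound (rho : R) (p q : CR) :
  0 < rho -> on_sphere gCR rho p -> on_sphere gCR rho q ->
  -1 <= gCR p q / rho ^ 2 <= 1.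
Proof.
  unfold on_sphere. intros Hrho Hp Hq.
  assert (H := gCR_nonneg (cross p q)). rewrite cross_norm, Hp, Hq in H.
  assert (0 < rho ^ 2) by nra.
  assert (E : gCR p q = gCR p q / rho ^ 2 * rho ^ 2) by (field; lra).
  revert H E. generalize (gCR p q / rho ^ 2); intros x H E. rewrite E in H.
  assert (Hx : x ^ 2 <= 1).
  { apply (Rmult_le_reg_l (rho ^ 2 * rho ^ 2)); [nra|]. lra. }
  nra.
Qed.

(** The factor [k] keeps the argument of [acos] away from [-1] and [1], where it is not
    differentiable; for [k = 1] this would be the bound of the angle by the length. *)
Lemma angle_growth (rho k : R) (c c' : R -> CR) :
  0 < rho -> 0 <= k < 1 ->
  (forall t, 0 <= t <= 1 ->
     on_sphere gCR rho (c t) /\ is_derive c t (c' t) /\ continuous c' t) ->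
  acos (k * (gCR (c 0) (c 1) / rho ^ 2)) - acos (k * (gCR (c 0) (c 0) / rho ^ 2))
  <= RInt (fun t => sqrt (gCR (c' t) (c' t))) 0 1 / rho.
Proof.
  intros Hrho Hk Hc.
  assert (Hrho2 : 0 < rho ^ 2) by nra.
  set (f := fun t => k * (gCR (c 0) (c t) / rho ^ 2)).
  set (df := fun t => k * (gCR (c 0) (c' t) / rho ^ 2)).
  assert (Hf : forall t, 0 <= t <= 1 -> -1 < f t < 1).
  { intros t Ht. destruct (Hc t Ht) as [St _]. destruct (Hc 0 ltac:(lra)) as [S0 _].
    assert (B := sphere_gCR_bound rho _ _ Hrho S0 St). unfold f. nra. }
  assert (Df : forall t, 0 <= t <= 1 -> is_derive f t (df t)).
  { intros t Ht. destruct (Hc t Ht) as [_ [Dc _]].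
    assert (H := is_derive_gCR (fun _ => c 0) _ _ _ _ (is_derive_const (c 0) t) Dc).
    apply (is_derive_scal _ t (k / rho ^ 2)) in H.
    assert (Ef : forall x, k / rho ^ 2 * gCR (c 0) (c x) = f x)
      by (intros x; unfold f; field; lra).
    apply (is_derive_ext _ f) in H; [|exact Ef].
    evar_last; [exact H|]. unfold df.
    match goal with |- @eq _ ?a ?b => change (@eq R a b) end.
    replace (gCR zero (c t)) with 0;
      [|generalize (c t); intros; coordinates; ring].
    field; lra. }
  assert (Cdf : forall t, 0 <= t <= 1 -> continuous df t).
  { intros t Ht. destruct (Hc t Ht) as [_ [_ Cc]].
    apply (continuous_scal_r (K := R_AbsRing) (V := R_NormedModule) k).
    apply (continuous_scal_l (K := R_AbsRing) (V := R_NormedModule)).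
    apply continuous_gCR; [apply continuous_const|exact Cc]. }
  set (dG := fun t => df t * - / sqrt (1 - f t ^ 2)).
  assert (HG : is_RInt dG 0 1 (acos (f 1) - acos (f 0))).
  { apply (is_RInt_derive (V := R_CompleteNormedModule) (fun t => acos (f t)));
      rewrite Rmin_left, Rmax_right by lra; intros t Ht.
    - apply (is_derive_comp acos f); [apply is_derive_acos|apply Df]; auto.
    - apply (continuous_mult (K := R_AbsRing)); [now apply Cdf|].
      apply (continuous_comp f (fun x => - / sqrt (1 - x ^ 2))).
      + apply (ex_derive_continuous (V := R_NormedModule)). exists (df t). now apply Df.
      + apply (ex_derive_continuous (V := R_NormedModule)). auto_derive.
        assert (B := Hf t Ht). assert (0 < 1 - f t ^ 2) by nra.
        repeat split; [nra|]. apply Rgt_not_eq, sqrt_lt_R0. nra. }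
  change (acos (f 1) - acos (f 0) <= RInt (fun t => sqrt (gCR (c' t) (c' t))) 0 1 / rho).
  assert (EL : ex_RInt (fun t => sqrt (gCR (c' t) (c' t))) 0 1).
  { apply (ex_RInt_continuous (V := R_CompleteNormedModule)).
    rewrite Rmin_left, Rmax_right by lra. intros t Ht.
    destruct (Hc t Ht) as [_ [_ Cc]].
    apply (continuous_comp (fun t => gCR (c' t) (c' t)) sqrt).
    - now apply continuous_gCR.
    - apply continuous_sqrt. }
  rewrite <- (is_RInt_unique _ _ _ _ HG).
  unfold Rdiv. rewrite (Rmult_comm (RInt _ _ _)).
  change (RInt dG 0 1 <= scal (/ rho) (RInt (V := R_CompleteNormedModule)
    (fun t => sqrt (gCR (c' t) (c' t))) 0 1)).
  rewrite <- (RInt_scal (V := R_CompleteNormedModule) _ 0 1 (/ rho) EL).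
  apply RInt_le; [lra|eexists; exact HG
    |exact (ex_RInt_scal (V := R_NormedModule) _ 0 1 (/ rho) EL)|].
  intros t Ht. unfold dG.
  destruct (Hc t ltac:(lra)) as [St [Dc _]]. destruct (Hc 0 ltac:(lra)) as [S0 _].
  assert (Tan : gCR (c t) (c' t) = 0).
  { apply (velocity_tangent_to_sphere rho c t); [|exact Dc].
    apply (locally_interval _ t (Finite 0) (Finite 1)); simpl; try lra.
    intros y H0 H1. apply Hc. lra. }
  assert (G := gram_inequality (c 0) (c t) (c' t) Tan).
  assert (B := Hf t ltac:(lra)).
  change (scal (/ rho) (sqrt (gCR (c' t) (c' t)))) with (/ rho * sqrt (gCR (c' t) (c' t))).
  unfold on_sphere in St, S0. rewrite St, S0 in G.
  assert (Hw : 0 < sqrt (1 - f t ^ 2)) by (apply sqrt_lt_R0; nra).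
  assert (Hv := gCR_nonneg (c' t)).
  set (v := sqrt (gCR (c' t) (c' t))).
  set (w := sqrt (1 - f t ^ 2)) in *.
  assert (Ev : v ^ 2 = gCR (c' t) (c' t)) by now apply pow2_sqrt.
  assert (Ew : w ^ 2 = 1 - f t ^ 2) by (apply pow2_sqrt; nra).
  assert (Hv0 : 0 <= v) by apply sqrt_pos.
  rewrite <- Ev in G.
  (* Since [f] carries the factor [k], the Gram inequality bounds [(rho * df t) ^ 2] by
     [(k ^ 2 - f t ^ 2) * v ^ 2], and [k ^ 2 <= 1]. *)
  assert (Key : (rho * df t) ^ 2 <= (w * v) ^ 2).
  { assert (Ea : gCR (c 0) (c t) = rho ^ 2 * (gCR (c 0) (c t) / rho ^ 2)) by (field; lra).
    assert (Eb : gCR (c 0) (c' t) = rho ^ 2 * (gCR (c 0) (c' t) / rho ^ 2)) by (field; lra).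
    rewrite Ea, Eb in G. rewrite Rpow_mult_distr, (Rpow_mult_distr w), Ew. unfold df, f.
    revert G. generalize (gCR (c 0) (c t) / rho ^ 2) (gCR (c 0) (c' t) / rho ^ 2).
    intros a b G.
    assert (G' : rho ^ 2 * b ^ 2 <= (1 - a ^ 2) * v ^ 2).
    { apply (Rmult_le_reg_l (rho ^ 2 * rho ^ 2)); [nra|]. lra. }
    assert (0 <= v ^ 2) by nra. assert (0 <= rho ^ 2 * b ^ 2) by nra.
    assert (k ^ 2 <= 1) by nra.
    apply Rle_trans with (k ^ 2 * ((1 - a ^ 2) * v ^ 2)); [|nra].
    replace (rho ^ 2 * (k * b) ^ 2) with (k ^ 2 * (rho ^ 2 * b ^ 2)) by ring.
    apply Rmult_le_compat_l; nra. }
  assert (Key' : - (rho * df t) <= w * v).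
  { apply Rsqr_incr_0_var; [unfold Rsqr; nra|nra]. }
  apply (Rmult_le_reg_l (rho * w)); [nra|].
  replace (rho * w * (df t * - / w)) with (- (rho * df t)) by (field; lra).
  replace (rho * w * (/ rho * v)) with (w * v) by (field; lra).
  exact Key'.
Qed.

Lemma length_lower_bound (rho : R) (c c' : R -> CR) :
  0 < rho ->
  (forall t, 0 <= t <= 1 ->
     on_sphere gCR rho (c t) /\ is_derive c t (c' t) /\ continuous c' t) ->
  rho * acos (gCR (c 0) (c 1) / rho ^ 2)
  <= RInt (fun t => sqrt (gCR (c' t) (c' t))) 0 1.
Proof.
  intros Hrho Hc.
  assert (S0 : on_sphere gCR rho (c 0)) by (apply Hc; lra).
  assert (S1 : on_sphere gCR rho (c 1)) by (apply Hc; lra).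
  assert (B := sphere_gCR_bound rho _ _ Hrho S0 S1).
  set (F := gCR (c 0) (c 1) / rho ^ 2) in *.
  set (L := RInt (fun t => sqrt (gCR (c' t) (c' t))) 0 1).
  (* Take [k = cos d]: the shrunken angle then starts at [d] instead of [0]. *)
  assert (A : forall d, 0 < d < PI / 2 -> acos (cos d * F) <= d + L / rho).
  { intros d Hd.
    assert (Hk : 0 <= cos d < 1).
    { split; [apply cos_ge_0; lra|]. rewrite <- cos_0. apply cos_decreasing_1; lra. }
    assert (H := angle_growth rho (cos d) c c' Hrho Hk Hc). fold F L in H.
    replace (cos d * (gCR (c 0) (c 0) / rho ^ 2)) with (cos d) in H.
    - rewrite acos_cos in H; lra.
    - unfold on_sphere in S0. rewrite S0. field. lra. }
  apply Rnot_lt_le. intros HL.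
  assert (HL' : L / rho < acos F).
  { apply (Rmult_lt_reg_l rho); [lra|]. assert (E : rho * (L / rho) = L :> R) by (field; lra).
    rewrite E. exact HL. }
  assert (BF := acos_bound F).
  assert (HP := PI_RGT_0).
  assert (L0 : 0 <= L / rho).
  { apply le_epsilon. intros eps Heps.
    set (d := Rmin eps (PI / 4)).
    assert (0 < d <= eps /\ d <= PI / 4).
    { unfold d. assert (H1 := Rmin_l eps (PI / 4)). assert (H2 := Rmin_r eps (PI / 4)).
      repeat split; try easy. apply Rmin_glb_lt; lra. }
    assert (H1 := A d ltac:(lra)). assert (H2 := acos_bound (cos d * F)). lra. }
  assert (Hlt : F - cos (L / rho) < 0).
  { rewrite <- (cos_acos F B).
    assert (cos (acos F) < cos (L / rho)) by (apply cos_decreasing_1; lra). lra. }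
  (* [A d] amounts to [cos (d + L / rho) <= cos d * F], which fails near [d = 0]. *)
  assert (Cphi : continuous (fun d => cos d * F - cos (d + L / rho)) 0).
  { apply (ex_derive_continuous (V := R_NormedModule)). now auto_derive. }
  assert (Hloc : locally 0 (fun d => cos d * F - cos (d + L / rho) < 0)).
  { apply (Cphi (fun y => y < 0)). rewrite cos_0, Rplus_0_l, Rmult_1_l. now apply open_lt. }
  destruct Hloc as [eps Heps].
  set (d := Rmin (eps / 2) (Rmin (PI / 4) ((PI - L / rho) / 2))).
  assert (Hd : 0 < d /\ d <= eps / 2 /\ d <= PI / 4 /\ d <= (PI - L / rho) / 2).
  { assert (He := cond_pos eps). unfold d. repeat split.
    - repeat apply Rmin_glb_lt; lra.
    - apply Rmin_l.
    - eapply Rle_trans; [apply Rmin_r|apply Rmin_l].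
    - eapply Rle_trans; [apply Rmin_r|apply Rmin_r]. }
  assert (N : cos d * F - cos (d + L / rho) < 0).
  { apply Heps. assert (He := cond_pos eps). change (Rabs (d - 0) < eps).
    rewrite Rminus_0_r, Rabs_pos_eq; lra. }
  assert (H1 := A d ltac:(lra)).
  assert (Hc1 := COS_bound d).
  assert (Hk : 0 <= cos d) by (apply cos_ge_0; lra).
  assert (H2 := acos_bound (cos d * F)).
  assert (H3 : cos (d + L / rho) <= cos (acos (cos d * F))) by (apply cos_decr_1; lra).
  rewrite cos_acos in H3; [lra|nra].
Qed.

Lemma exists_orthogonal (rho : R) (p : CR) :
  0 < rho -> exists e : CR, on_sphere gCR rho e /\ gCR p e = 0.
Proof.
  intros Hrho. destruct p as [[a b] z].
  destruct (Req_dec (a ^ 2 + b ^ 2) 0) as [H|H].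
  - exists ((rho, 0), 0). assert (a = 0) by nra. subst a.
    split; coordinates; ring.
  - set (n := sqrt (a ^ 2 + b ^ 2)).
    assert (Hn : n ^ 2 = a ^ 2 + b ^ 2) by (apply pow2_sqrt; nra).
    assert (Hn0 : n <> 0) by (intros E; rewrite E in Hn; lra).
    exists ((rho * - b / n, rho * a / n), 0).
    split; unfold on_sphere; [|coordinates; now field].
    apply (Rmult_eq_reg_l (n ^ 2)); [|now apply pow_nonzero].
    transitivity (rho ^ 2 * (a ^ 2 + b ^ 2));
      [clear Hn; coordinates; now field|rewrite Hn; ring].
Qed.

Lemma great_circle_decomposition (rho : R) (p q : CR) :
  0 < rho -> on_sphere gCR rho p -> on_sphere gCR rho q ->
  let theta := acos (gCR p q / rho ^ 2) in
  exists e : CR, on_sphere gCR rho e /\ gCR p e = 0 /\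
    q = plus (scal (cos theta) p) (scal (sin theta) e).
Proof.
  intros Hrho Hp Hq theta.
  assert (B := sphere_gCR_bound rho p q Hrho Hp Hq).
  assert (Hrho2 : 0 < rho ^ 2) by nra.
  assert (Hc : rho ^ 2 * cos theta = gCR p q).
  { unfold theta; rewrite cos_acos by easy. field; lra. }
  assert (Hcs : sin theta ^ 2 = 1 - cos theta ^ 2).
  { assert (H := sin2_cos2 theta). unfold Rsqr in H. lra. }
  unfold on_sphere in *.
  assert (Hn : gCR (minus q (scal (cos theta) p)) (minus q (scal (cos theta) p))
    = rho ^ 2 * sin theta ^ 2).
  { transitivity (gCR q q - 2 * cos theta * gCR p q + cos theta ^ 2 * gCR p p).
    - generalize (cos theta); clear; intros; coordinates; ring.
    - rewrite Hp, Hq, <- Hc, Hcs. ring. }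
  destruct (Req_dec (sin theta) 0) as [Hs|Hs].
  - (* [q = p] or [q = - p]: any direction will do *)
    destruct (exists_orthogonal rho p Hrho) as [e [He Hpe]].
    exists e. split; [easy|split; [easy|]].
    rewrite Hs in Hn |- *. replace (rho ^ 2 * 0 ^ 2) with 0 in Hn by ring.
    apply gCR_pos_def in Hn. revert Hn. generalize (cos theta); clear; intros k Hn.
    transitivity (plus (minus q (scal k p)) (scal k p));
      [|rewrite Hn]; apply CR_ext; coordinates; ring.
  - exists (scal (/ sin theta) (minus q (scal (cos theta) p))).
    split; [|split].
    + rewrite gCR_scal_l, gCR_scal_r, Hn. now field.
    + rewrite gCR_scal_r.
      transitivity (/ sin theta * (gCR p q - cos theta * gCR p p)).
      * f_equal. generalize (cos theta); clear; intros; coordinates; ring.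
      * rewrite Hp, <- Hc. ring.
    + revert Hs; generalize (cos theta) (sin theta); clear; intros k m Hm.
      apply CR_ext; coordinates; now field.
Qed.

Lemma great_circle_arc (rho : R) (p q : CR) :
  0 < rho -> on_sphere gCR rho p -> on_sphere gCR rho q ->
  is_curve_length gCR rho p q (rho * acos (gCR p q / rho ^ 2)).
Proof.
  intros Hrho Hp Hq.
  destruct (great_circle_decomposition rho p q Hrho Hp Hq) as [e [He [Hpe Hqe]]].
  set (theta := acos (gCR p q / rho ^ 2)) in *.
  assert (Ht0 : 0 <= theta) by apply acos_bound.
  unfold on_sphere in *.
  set (arc := fun (a b : R) => plus (scal a p) (scal b e)).
  assert (Harc : forall a b, gCR (arc a b) (arc a b) = rho ^ 2 * (a ^ 2 + b ^ 2)).
  { intros a b. transitivity (a ^ 2 * gCR p p + 2 * a * b * gCR p e + b ^ 2 * gCR e e).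
    - unfold arc; clear; coordinates; ring.
    - rewrite Hp, He, Hpe; ring. }
  assert (Darc : forall (a b : R -> R) t da db, is_derive a t da -> is_derive b t db ->
    is_derive (fun x => arc (a x) (b x)) t (arc da db)).
  { intros a b t da db Ha Hb. unfold arc.
    exact (is_derive_plus _ _ _ _ _
      (is_derive_linear_image (U := R_NormedModule) (fun k => scal k p) a t da
        (is_linear_scal_l p) Ha)
      (is_derive_linear_image (U := R_NormedModule) (fun k => scal k e) b t db
        (is_linear_scal_l e) Hb)). }
  exists (fun t => arc (cos (theta * t)) (sin (theta * t))),
    (fun t => arc (- theta * sin (theta * t)) (theta * cos (theta * t))).
  split; [|split; [|split]].
  - rewrite Rmult_0_r, cos_0, sin_0. unfold arc; clear. apply CR_ext; coordinates; ring.
  - rewrite Rmult_1_r. symmetry. exact Hqe.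
  - intros t _. unfold on_sphere. split; [|split].
    + rewrite Harc. assert (H := sin2_cos2 (theta * t)). unfold Rsqr in H.
      replace (cos (theta * t) ^ 2 + sin (theta * t) ^ 2) with 1 by lra. ring.
    + apply Darc; auto_derive; easy || ring.
    + apply (ex_derive_continuous (V := CR)).
      exists (arc (- theta * (theta * cos (theta * t))) (theta * - (theta * sin (theta * t)))).
      apply Darc; auto_derive; easy || ring.
  - rewrite (RInt_ext _ (fun _ => rho * theta)).
    + rewrite RInt_const. change (rho * theta = (1 - 0) * (rho * theta)). ring.
    + intros t _. rewrite Harc. assert (H := sin2_cos2 (theta * t)). unfold Rsqr in H.
      replace (rho ^ 2 * _) with ((rho * theta) ^ 2 *
        (sin (theta * t) * sin (theta * t) + cos (theta * t) * cos (theta * t))) by ring.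
      rewrite H, Rmult_1_r. apply sqrt_pow2. nra.
Qed.

Lemma sphere_dist_acos (rho : R) (p q : CR) :
  0 < rho -> on_sphere gCR rho p -> on_sphere gCR rho q ->
  sphere_dist gCR rho p q = Finite (rho * acos (gCR p q / rho ^ 2)).
Proof.
  intros Hrho Hp Hq. apply is_glb_Rbar_unique. split.
  - intros L (c & c' & <- & <- & Hc & ->). now apply length_lower_bound.
  - intros b Hb. apply Hb. now apply great_circle_arc.
Qed.

Lemma geodesic_circle_height (rho theta : R) (p q : CR) :
  0 < rho -> 0 <= theta <= PI -> on_sphere gCR rho p ->
  geodesic_circle gCR rho p (rho * theta) q <->
  on_sphere gCR rho q /\ gCR p q = rho ^ 2 * cos theta.
Proof.
  intros Hrho Ht Hp. unfold geodesic_circle.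
  assert (Hrho2 : 0 < rho ^ 2) by nra.
  split; intros [Hq H]; split; try easy.
  - rewrite sphere_dist_acos in H by easy. injection H as H.
    apply Rmult_eq_reg_l in H; [|lra].
    rewrite <- H, cos_acos by now apply sphere_gCR_bound. field; lra.
  - rewrite sphere_dist_acos by easy. rewrite H.
    replace (rho ^ 2 * cos theta / rho ^ 2) with (cos theta) by (field; lra).
    now rewrite acos_cos.
Qed.

(** * The angle of the vector C *)

Lemma Arg_bound (c : R * R) : 0 <= Arg c <= PI.
Proof.
  unfold Arg. assert (H := PI_RGT_0).
  destruct Req_EM_T; [lra|apply acos_bound].
Qed.

Lemma sum_of_squares_pos (x y : R) : (x, y) <> (0, 0) -> 0 < x ^ 2 + y ^ 2.
Proof. intros H. apply Rnot_le_lt. intros Hle. apply H. f_equal; nra. Qed.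

Lemma cos_Arg (x y : R) : (x, y) <> (0, 0) -> cos (Arg (x, y)) = x / sqrt (x ^ 2 + y ^ 2).
Proof.
  intros H. unfold Arg; simpl fst; simpl snd.
  assert (Hpos := sum_of_squares_pos x y H).
  assert (Hn := sqrt_lt_R0 _ Hpos).
  destruct Req_EM_T as [E|_]; [lra|].
  apply cos_acos.
  assert (Hn2 : sqrt (x ^ 2 + y ^ 2) ^ 2 = x ^ 2 + y ^ 2) by (apply pow2_sqrt; lra).
  set (n := sqrt (x ^ 2 + y ^ 2)) in *.
  assert (Hz : n ^ 2 * (x / n) ^ 2 = x ^ 2) by (field; lra).
  assert ((x / n) ^ 2 <= 1) by (apply (Rmult_le_reg_l (n ^ 2)); nra).
  nra.
Qed.

(** The vector has polar angle [Arg (x, y)] because [0 < y]; the case [Arg (x, y) = PI / 2] is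
    [x = 0]. *)
Lemma two_over_tan_Arg (x y : R) : 0 < y -> two_over_tan (Arg (x, y)) = 2 * x / y.
Proof.
  intros Hy.
  assert (Hne : (x, y) <> (0, 0)) by (intros E; injection E; lra).
  assert (Hc := cos_Arg x y Hne). assert (B := Arg_bound (x, y)).
  set (theta := Arg (x, y)) in *.
  assert (Hn2 : sqrt (x ^ 2 + y ^ 2) ^ 2 = x ^ 2 + y ^ 2) by (apply pow2_sqrt; nra).
  assert (Hn : 0 < sqrt (x ^ 2 + y ^ 2)) by (apply sqrt_lt_R0; nra).
  set (n := sqrt (x ^ 2 + y ^ 2)) in *.
  assert (Hx : x = n * cos theta) by (rewrite Hc; field; lra).
  assert (Hs0 : 0 <= sin theta) by (apply sin_ge_0; lra).
  assert (Hs : y = n * sin theta).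
  { assert (H := sin2_cos2 theta). unfold Rsqr in H.
    apply Rsqr_inj; [lra|nra|]. unfold Rsqr. rewrite Hx in Hn2 at 1. nra. }
  unfold two_over_tan. destruct Req_EM_T as [E|E].
  - rewrite E, cos_PI2 in Hx. rewrite Hx. field. lra.
  - assert (sin theta <> 0) by (intros Z; rewrite Z in Hs; lra).
    assert (cos theta <> 0).
    { intros Z. apply E. rewrite <- (acos_cos theta B), Z. apply acos_0. }
    rewrite Hs, Hx. unfold tan. field. repeat split; try easy; lra.
Qed.

(** A zero second component leaves [cos psi = 1] or [cos psi = - 1], and the latter would make
    [s] negative. *)
Lemma C_vec_nonzero (s psi : R) :
  0 <= s -> 0 <= psi <= PI -> (s, psi) <> (2, 0) -> C_vec s psi <> (0, 0).
Proof.
  intros Hs Hpsi Hne E. unfold C_vec in E. injection E as Ec Es. apply Hne.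
  assert (H := sin2_cos2 psi). unfold Rsqr in H. rewrite Es in H.
  assert (Hc : cos psi = 1) by nra.
  f_equal; [lra|]. rewrite <- (acos_cos psi Hpsi), Hc. apply acos_1.
Qed.

Lemma is_reparam_linear (a : R) : 0 < a -> is_reparam (fun t => a * t).
Proof.
  intros Ha. split; [|split].
  - intros n t. apply ex_derive_n_scal_l.
    destruct n as [|[|n]]; [easy| |].
    + apply ex_derive_id.
    + (* the higher derivatives of the identity are constant *)
      apply (ex_derive_ext (fun _ => match n with O => 1 | _ => 0 end));
        [|apply ex_derive_const].
      clear t Ha a. induction n as [|n IH]; intros t.
      * simpl. now rewrite Derive_id.
      * change (0 = Derive (Derive_n (fun x => x) (S n)) t).
        rewrite <- (Derive_ext _ _ t IH). now rewrite Derive_const.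
  - intros t. rewrite Derive_scal, Derive_id. lra.
  - intros y. exists (y / a). field. lra.
Qed.

(** * Projections of magnetic geodesics *)

Theorem theorem1p12 (s psi : R) (gam : R -> C2)
    (hs : 0 <= s)
    (hgeo : is_magnetic_geodesic gC2 1 (scale_form s (ext_deriv alpha)) gam)
    (hspeed : has_speed gC2 gam 1)
    (hpsi : contact_angle gam psi) :
  (exists b c : R,
     is_magnetic_geodesic gCR (/ 2) (scale_form b area_form) (fun t : R => hopf (gam t)) /\
     has_speed gCR (fun t : R => hopf (gam t)) c) /\
  (0 < psi < PI ->
     a_s s psi = (2 * cos psi - s) / sin psi /\
     exists phi : R -> R,
       is_reparam phi /\
       is_magnetic_geodesic gCR (/ 2) (scale_form (- a_s s psi) area_form)
         (fun t : R => hopf (gam (phi t))) /\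
       has_speed gCR (fun t : R => hopf (gam (phi t))) 1) /\
  0 <= r_s s psi <= PI / 2 /\
  ((s, psi) <> (2, 0) ->
     exists p : CR,
       on_sphere gCR (/ 2) p /\
       forall q : CR,
         (exists t : R, hopf (gam t) = q) <-> geodesic_circle gCR (/ 2) p (r_s s psi) q).
Proof.
  destruct (contact_magnetic_geodesic_of_curve s psi gam hgeo hspeed hpsi)
    as (gam' & gam'' & Hgam).
  assert (Hh := hopf_projection _ _ _ _ _ Hgam).
  assert (Hcs : 1 - cos psi ^ 2 = sin psi ^ 2)
    by (assert (H := sin2_cos2 psi); unfold Rsqr in H; lra).
  rewrite Hcs in Hh. destruct hpsi as [Hpsi _].
  assert (Hr := Arg_bound (C_vec s psi)).
  split; [|split; [|split]].
  - exists (s - 2 * cos psi), (sqrt (sin psi ^ 2)).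
    now apply magnetic_equation_geodesic in Hh.
  - intros Hpsi'.
    assert (Hsin : 0 < sin psi) by now apply sin_gt_0.
    assert (Ha : a_s s psi = (2 * cos psi - s) / sin psi).
    { unfold a_s, C_vec. rewrite two_over_tan_Arg by easy. field. lra. }
    split; [exact Ha|].
    exists (fun t => / sin psi * t). split.
    + now apply is_reparam_linear, Rinv_0_lt_compat.
    + apply (magnetic_equation_rescale _ _ (/ sin psi)), magnetic_equation_geodesic in Hh.
      replace ((/ sin psi) ^ 2 * sin psi ^ 2) with 1 in Hh by (field; lra).
      rewrite sqrt_1 in Hh.
      replace (- a_s s psi) with (/ sin psi * (s - 2 * cos psi))
        by (rewrite Ha; field; lra).
      exact Hh.
  - unfold r_s. lra.
  - intros Hne.
    assert (HC := C_vec_nonzero s psi hs Hpsi Hne).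
    set (n := sqrt ((- (s / 2) + cos psi) ^ 2 + sin psi ^ 2)).
    assert (Hpos := sum_of_squares_pos _ _ HC).
    assert (Hn : 0 < n) by now apply sqrt_lt_R0.
    assert (Hn2 : n ^ 2 = (- (s / 2) + cos psi) ^ 2 + sin psi ^ 2)
      by (apply pow2_sqrt; lra).
    (* Half of the frequency of the projected motion is the length [n] of [C_vec]. *)
    destruct (magnetic_equation_circle _ _ (2 * n) _ _ Hh) as [p [Hp Horb]]; [lra| |].
    { replace ((2 * n) ^ 2) with (4 * n ^ 2) by ring. rewrite Hn2. field. }
    exists p. split; [exact Hp|]. intros q.
    rewrite Horb. unfold r_s. rewrite geodesic_circle_height; [|lra|exact Hr|exact Hp].
    unfold C_vec. rewrite cos_Arg by exact HC. fold n.
    replace (- (s - 2 * cos psi) / (2 * n)) with ((- (s / 2) + cos psi) / n) by (field; lra).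
    easy.
Qed.
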